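(* Let $\mathcal{G}$ be a graph with an adapted complex structure $J$, and let $\mathcal{G}_b$ denote the associated basic subgraph. If $\mathcal{G}_b=(0,0,n)$ for some $n\in\mathbb{N}$ then the set of distinguished edges is a perfect matching in $\mathcal{G}$.
   Context: Graphs are finite and simple. A perfect matching in $\mathcal{G}=(V,E)$ is a subset $M\subseteq E$ such that every vertex in $V$ is an endpoint of exactly one edge in $M$. Label $V=\{v_1,\dots,v_N\}$ and write $e_{i,j}$ ($i<j$) for the edge joining $v_i$ and $v_j$, if it exists. The Lie algebra $\mathfrak{n}_{\mathcal{G}}$ is the real vector space with basis $V\cup E$ and Lie bracket $[v_i,v_j]=e_{i,j}$ for $i<j$ if $v_i,v_j$ are adjacent, $[v_i,v_j]=0$ if they are not adjacent, and all elements of $E$ central. A complex structure on a real Lie algebra $\mathfrak{g}$ is a linear map $J:\mathfrak{g}\to\mathfrak{g}$ with $J^2=-\mathrm{Id}$ and $[x,y]+J([Jx,y]+[x,Jy])-[Jx,Jy]=0$ for all $x,y\in\mathfrak{g}$. An adapted complex structure on the graph $\mathcal{G}$ is a complex structure $J$ on $\mathfrak{n}_{\mathcal{G}}$ such that for every $x\in V\cup E$ either $Jx\in V\cup E$ or $-Jx\in V\cup E$. An edge is distinguished if it joins a pair of vertices $v,w$ with $w=Jv$. Associated basic subgraph: $\mathcal{G}_b$ is the spanning subgraph of $\mathcal{G}$ (same vertices) whose edges are exactly the distinguished edges of $(\mathcal{G},J)$. It is $J$-invariant (up to sign) and decomposes as a disjoint union of $J$-invariant subgraphs of the following types: $\mathbb{A}_1$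 (two vertices $v,\pm Jv$, no edge); $\mathbb{A}_2$ (an edge $\overline{v\,w}$ with $w=Jv$, together with one further vertex $u$ with $\pm Ju=\overline{v\,w}$); $\mathbb{A}_3$ (two disjoint edges $a$, $\pm Ja$, each of the form $\overline{v\,w}$ with $w=Jv$). The notation $\mathcal{G}_b=(p_1,p_2,p_3)$ means that there are $p_i$ copies of $\mathbb{A}_i$, $i=1,2,3$, in this decomposition. *)

(* Defs.v *)
From HB Require Import structures.
From mathcomp Require Import all_boot all_order all_algebra.
From mathcomp Require Import reals.

Set Implicit Arguments.
Unset Strict Implicit.
Unset Printing Implicit Defensive.

Import Order.TTheory GRing.Theory Num.Theory.
Local Open Scope ring_scope.

Record lieAlgebra (K : fieldType) := LieAlgebra {
  lie_sort :> lmodType K;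
  lie_bracket : lie_sort -> lie_sort -> lie_sort;
  lie_bracketDl : forall (a : K) (x y z : lie_sort),
    lie_bracket (a *: x + y) z = a *: lie_bracket x z + lie_bracket y z;
  lie_bracketDr : forall (a : K) (x y z : lie_sort),
    lie_bracket z (a *: x + y) = a *: lie_bracket z x + lie_bracket z y;
  lie_bracketxx : forall x : lie_sort, lie_bracket x x = 0;
  lie_jacobi : forall x y z : lie_sort,
    lie_bracket x (lie_bracket y z) + lie_bracket y (lie_bracket z x)
      + lie_bracket z (lie_bracket x y) = 0
}.

Definition complex_structure (K : fieldType) (g : lieAlgebra K)
    (J : {linear g -> g}) : Prop :=
  (forall x : g, J (J x) = - x) /\
  (forall x y : g,
     lie_bracket x y + J (lie_bracket (J x) y + lie_bracket x (J y))
       - lie_bracket (J x) (J y) = 0).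

(* A finite simple graph with labelled vertices v_0, ..., v_{N-1}. *)
Record sgraph (N : nat) := SGraph {
  adj : rel 'I_N;
  adj_sym : symmetric adj;
  adj_irr : irreflexive adj
}.

(* The edge e_{i,j} is encoded by the pair (i, j) with i < j. *)
Definition is_edge (N : nat) (G : sgraph N) : pred ('I_N * 'I_N) :=
  [pred p : 'I_N * 'I_N | (p.1 < p.2)%N && adj G p.1 p.2].

Definition edge (N : nat) (G : sgraph N) : finType := {p | is_edge G p}.

Definition joins (N : nat) (G : sgraph N) (e : edge G) (v w : 'I_N) : bool :=
  (val e == (v, w)) || (val e == (w, v)).

Definition endpoint (N : nat) (G : sgraph N) (e : edge G) (v : 'I_N) : bool :=
  (v == (val e).1) || (v == (val e).2).

Definition perfect_matching (N : nat) (G : sgraph N) (M : {set edge G}) : Prop :=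
  forall v : 'I_N, exists! e : edge G, e \in M /\ endpoint e v.

(* The disjoint union of V and E. *)
Definition elt (N : nat) (G : sgraph N) : finType := ('I_N + edge G)%type.

Section GraphLie.
Variables (R : realType) (N : nat) (G : sgraph N).

Local Notation vect := {ffun elt G -> R^o}.

Definition delta (a : elt G) : vect := [ffun b => (b == a)%:R].

(* insub (i, j) is Some e_{i,j} exactly when i < j and v_i, v_j are adjacent. *)
Definition delta_bracket (a b : elt G) : vect :=
  match a, b with
  | inl i, inl j =>
      match insub (i, j) : option (edge G), insub (j, i) : option (edge G) with
      | Some e, _ => delta (inr e)
      | None, Some e => - delta (inr e)
      | None, None => 0
      end
  | _, _ => 0
  end.

Definition graph_bracket (x y : vect) : vect :=
  \sum_(a : elt G) \sum_(b : elt G) (x a * y b) *: delta_bracket a b.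

Lemma delta_bracketN a b : delta_bracket a b = - delta_bracket b a.
Proof.
case: a b => [i|e] [j|f] /=; rewrite ?oppr0 //.
case: insubP => [e /andP[/= lij _] _|_]; case: insubP => [f /andP[/= lji _] _|_];
  rewrite ?opprK ?oppr0 //.
by have := ltn_trans lij lji; rewrite ltnn.
Qed.

Lemma graph_bracketDl (a : R) (x y z : vect) :
  graph_bracket (a *: x + y) z = a *: graph_bracket x z + graph_bracket y z.
Proof.
rewrite /graph_bracket scaler_sumr -big_split; apply: eq_bigr => b _ /=.
rewrite scaler_sumr -big_split; apply: eq_bigr => c _ /=.
by rewrite !ffunE mulrDl scalerDl -mulrA scalerA.
Qed.

Lemma graph_bracketN (x y : vect) : graph_bracket x y = - graph_bracket y x.
Proof.
rewrite /graph_bracket exchange_big -sumrN; apply: eq_bigr => b _ /=.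
rewrite -sumrN; apply: eq_bigr => c _ /=.
by rewrite delta_bracketN scalerN mulrC.
Qed.

Lemma graph_bracketDr (a : R) (x y z : vect) :
  graph_bracket z (a *: x + y) = a *: graph_bracket z x + graph_bracket z y.
Proof.
by rewrite graph_bracketN graph_bracketDl opprD -scalerN -!graph_bracketN.
Qed.

Lemma graph_bracketxx (x : vect) : graph_bracket x x = 0.
Proof.
apply/ffunP => b; have /ffunP/(_ b) := graph_bracketN x x.
by rewrite !ffunE => /eqP; rewrite -subr_eq0 opprK -mulr2n mulrn_eq0 => /eqP.
Qed.

Lemma graph_bracket_inl (x y : vect) i : graph_bracket x y (inl i) = 0.
Proof.
rewrite sum_ffunE big1 // => a _; rewrite sum_ffunE big1 // => b _.
rewrite ffunE; suff -> : delta_bracket a b (inl i) = 0 by rewrite scaler0.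
case: a b => [j|e] [k|f] /=; rewrite ?ffunE //.
by case: insubP => [e _ _|_]; [|case: insubP => [e _ _|_]]; rewrite !ffunE ?oppr0.
Qed.

Lemma graph_bracket3 (x y z : vect) : graph_bracket x (graph_bracket y z) = 0.
Proof.
rewrite /graph_bracket big1 // => a _; rewrite big1 // => -[i|e] _.
  by rewrite -/(graph_bracket y z) graph_bracket_inl mulr0 scale0r.
by case: a => [j|f]; rewrite scaler0.
Qed.

Lemma graph_jacobi (x y z : vect) :
  graph_bracket x (graph_bracket y z) + graph_bracket y (graph_bracket z x)
    + graph_bracket z (graph_bracket x y) = 0.
Proof. by rewrite !graph_bracket3 !addr0. Qed.

Lemma graph_bracket_delta a b :
  graph_bracket (delta a) (delta b) = delta_bracket a b.
Proof.
rewrite /graph_bracket (bigD1 a) //= [X in _ + X]big1 ?addr0 => [|c /negPf nca].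
  rewrite (bigD1 b) //= [X in _ + X]big1 ?addr0 => [|c /negPf ncb].
    by rewrite !ffunE !eqxx mulr1 scale1r.
  by rewrite !ffunE ncb mulr0 scale0r.
by rewrite big1 // => d _; rewrite !ffunE nca mul0r scale0r.
Qed.

Definition graph_lie : lieAlgebra R :=
  LieAlgebra graph_bracketDl graph_bracketDr graph_bracketxx graph_jacobi.

Definition base (a : elt G) : graph_lie := delta a.

Definition vtx (v : 'I_N) : graph_lie := base (inl v).

Variable J : {linear graph_lie -> graph_lie}.

Definition adapted_complex_structure : Prop :=
  complex_structure J /\
  (forall a : elt G, exists b : elt G,
     J (base a) = base b \/ - J (base a) = base b).

Definition distinguished (e : edge G) : bool :=
  [exists v, exists w, joins e v w && (vtx w == J (vtx v))].

(* A subgraph of G is encoded by the set of its vertices and edges. *)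
Definition basic_subgraph : {set elt G} :=
  [set a : elt G | if a is inr e then distinguished e else true].

Definition J_paired (a b : elt G) : bool :=
  (J (base a) == base b) || (- J (base a) == base b).

Definition is_A1 (B : {set elt G}) : bool :=
  [exists v : 'I_N, exists w : 'I_N,
     (v != w) && J_paired (inl v) (inl w) && (B == [set inl v; inl w])].

Definition is_A2 (B : {set elt G}) : bool :=
  [exists v : 'I_N, exists w : 'I_N, exists u : 'I_N, exists e : edge G,
     [&& joins e v w, vtx w == J (vtx v), u != v, u != w,
         J_paired (inl u) (inr e)
       & B == [set inl v; inl w; inl u; inr e]]].

Definition is_A3 (B : {set elt G}) : bool :=
  [exists v : 'I_N, exists w : 'I_N, exists v' : 'I_N, exists w' : 'I_N,
   exists e : edge G, exists e' : edge G,
     [&& joins e v w, vtx w == J (vtx v), joins e' v' w', vtx w' == J (vtx v'),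
         [disjoint [set v; w] & [set v'; w']],
         J_paired (inr e) (inr e')
       & B == [set inl v; inl w; inl v'; inl w'; inr e; inr e']]].

(* The pieces of types A1, A2, A3 contain the endpoints of their edges, so a
   partition of the vertices and edges of the basic subgraph into such pieces
   is a decomposition as a disjoint union of subgraphs. *)
Definition basic_subgraph_type (p1 p2 p3 : nat) : Prop :=
  exists P : {set {set elt G}},
    [/\ partition P basic_subgraph,
        (forall B, B \in P -> [|| is_A1 B, is_A2 B | is_A3 B]),
        #|[set B in P | is_A1 B]| = p1,
        #|[set B in P | is_A2 B]| = p2
      & #|[set B in P | is_A3 B]| = p3].

End GraphLie.

(* Main.v *)
(** Every vertex lies in a piece of type A3, hence on one of its two
    distinguished edges. A distinguished edge at [v] joins [v] to the vertex
    [w] with [w = J v] or [w = - J v], so there is only one. *)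
Require Import Defs.
From mathcomp Require Import all_boot all_order all_algebra.
From mathcomp Require Import reals.

Set Implicit Arguments.
Unset Strict Implicit.
Unset Printing Implicit Defensive.

Import GRing.Theory.

Lemma joinsC (N : nat) (G : sgraph N) (e : edge G) (v w : 'I_N) :
  joins e v w = joins e w v.
Proof. exact: orbC. Qed.

Lemma joins_endpoint (N : nat) (G : sgraph N) (e : edge G) (v w x : 'I_N) :
  joins e v w -> endpoint e x = (x == v) || (x == w).
Proof. by rewrite /joins /endpoint => /orP[] /eqP-> //=; rewrite orbC. Qed.

(** An edge is stored as an increasing pair, so only one of [(v, w)] and [(w, v)] can occur. *)
Lemma joins_inj (N : nat) (G : sgraph N) (e f : edge G) (v w : 'I_N) :
  joins e v w -> joins f v w -> e = f.
Proof.
move=> /orP ev /orP fv; apply: val_inj.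
have /andP[lt_e _] := valP e; have /andP[lt_f _] := valP f.
by case: ev fv lt_e lt_f => /eqP-> [] /eqP-> //= /ltn_trans lt /lt; rewrite ltnn.
Qed.

Section GraphLieBasis.
Local Open Scope ring_scope.
Variables (R : realType) (N : nat) (G : sgraph N).

(** Needed because the partner of a vertex [v] is known only as a basis vector equal to plus or
    minus [J v]. *)
Lemma base_inj_sign (a b : elt G) (s t : bool) (x : graph_lie R G) :
  base R a = (-1) ^+ s *: x -> base R b = (-1) ^+ t *: x -> a = b.
Proof.
move=> ea eb; apply/eqP.
have /ffunP/(_ a) : base R a = (-1) ^+ (s (+) t) *: base R b.
  by rewrite ea eb scalerA signr_addb -mulrA -expr2 sqrr_sign mulr1.
(* At coordinate [a] the left side is 1, while the right side vanishes unless [a = b]. *)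
rewrite !ffunE eqxx; case: (a == b) => //= /eqP.
by rewrite scaler0 oner_eq0.
Qed.

Variable J : {linear graph_lie R G -> graph_lie R G}.

(** If [y = J x], then [x = - J y] since [J] squares to minus the identity. The sign [s] thus
    records which end of the edge [v] is. *)
Lemma distinguished_at (e : edge G) (v : 'I_N) :
  (forall x, J (J x) = - x) -> distinguished J e -> endpoint e v ->
  exists w (s : bool), joins e v w /\ vtx R G w = (-1) ^+ s *: J (vtx R G v).
Proof.
move=> JJ /existsP[x /existsP[y /andP[exy /eqP yJx]]].
rewrite (joins_endpoint _ exy) => /orP[] /eqP->.
  by exists y, false; rewrite scale1r.
by exists x, true; rewrite joinsC yJx JJ scaleN1r opprK.
Qed.

Lemma distinguished_unique (e f : edge G) (v : 'I_N) :
  (forall x, J (J x) = - x) -> distinguished J e -> distinguished J f ->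
  endpoint e v -> endpoint f v -> e = f.
Proof.
move=> JJ de df /(distinguished_at JJ de)[w [s [ew ws]]].
move=> /(distinguished_at JJ df)[u [t [fu ut]]].
have [wu] : @inl _ (edge G) w = inl u := base_inj_sign ws ut.
by rewrite -wu in fu; exact: joins_inj ew fu.
Qed.

Lemma A3_vertex_distinguished (B : {set elt G}) (v : 'I_N) :
  is_A3 J B -> inl v \in B -> exists2 e, distinguished J e & endpoint e v.
Proof.
case/existsP=> x /existsP[y /existsP[x' /existsP[y' /existsP[e /existsP[e']]]]].
case/and5P=> exy yJx exy' yJx' /and3P[_ _ /eqP->]; rewrite !inE /= !orbF.
have de : distinguished J e.
  by apply/existsP; exists x; apply/existsP; exists y; rewrite exy.
have de' : distinguished J e'.
  by apply/existsP; exists x'; apply/existsP; exists y'; rewrite exy'.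
(* The four vertices are grouped into the ends of [e] and the ends of [e']. *)
rewrite -orbA => /orP[vB|vB].
  by exists e; rewrite ?(joins_endpoint _ exy).
by exists e'; rewrite ?(joins_endpoint _ exy').
Qed.

Lemma basic_subgraph_type00_A3 (n : nat) (a : elt G) :
  basic_subgraph_type J 0 0 n -> a \in basic_subgraph J ->
  exists2 B, is_A3 J B & a \in B.
Proof.
case=> P [/cover_partition <- PA /cards0_eq noA1 /cards0_eq noA2 _].
case/bigcupP=> B BP aB; exists B => //.
(* The sets of A1 and A2 blocks are empty, so the first two alternatives for the block [B] are false
   and A3 remains. *)
have := PA B BP; have := in_set0 B; rewrite -{1}noA1 inE BP /= => ->.
by have := in_set0 B; rewrite -{1}noA2 inE BP /= => ->.
Qed.

End GraphLieBasis.

Theorem proposition6p14 (R : realType) (N : nat) (G : sgraph N)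
    (J : {linear graph_lie R G -> graph_lie R G})
    (hJ : adapted_complex_structure J)
    (n : nat) (hb : basic_subgraph_type J 0 0 n) :
  perfect_matching [set e : edge G | distinguished J e].
Proof.
have [[JJ _] _] := hJ; move=> v.
(* The basic subgraph is spanning, so it contains [v]. *)
have [|B A3B vB] := basic_subgraph_type00_A3 (a := inl v) hb; first by rewrite inE.
have [e de ev] := A3_vertex_distinguished A3B vB.
exists e; split=> [|f]; rewrite inE // => -[df fv].
exact: distinguished_unique JJ de df ev fv.
Qed.
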